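(* Let $G$ be an abelian group containing a torsion subgroup $T$ such that $G/T$ is a countable torsion-free group. Let $p$ be a prime and let $B_p$ be a basic subgroup of the $p$-primary component of $T$. Then $B_p$ is an endomorphic image of $G$, i.e., there is a homomorphism $G\to B_p$ which is surjective.
   Context: All groups are abelian. A basic subgroup $B$ of a $p$-group $A$ is a subgroup that is a direct sum of cyclic groups, is pure in $A$, and has $A/B$ divisible. *)

(* Defs.v *)
From HB Require Import structures.
From mathcomp Require Import all_boot all_algebra.
Set Implicit Arguments. Unset Strict Implicit. Unset Printing Implicit Defensive.
Import GRing.Theory.
Local Open Scope ring_scope.

Section AbelianGroups.
Variable G : zmodType.

Definition is_subgroup (H : G -> Prop) : Prop :=
  H 0 /\ (forall x y, H x -> H y -> H (x - y)).

Definition subgroup_of (H K : G -> Prop) : Prop :=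
  is_subgroup H /\ (forall x, H x -> K x).

Definition torsion_elt (x : G) : Prop := exists n : nat, (0 < n)%N /\ x *+ n = 0.

Definition torsion_subgroup (T : G -> Prop) : Prop :=
  is_subgroup T /\ (forall x, T x -> torsion_elt x).

Definition quotient_torsion_free (T : G -> Prop) : Prop :=
  forall (x : G) (n : nat), (0 < n)%N -> T (x *+ n) -> T x.

Definition quotient_countable (T : G -> Prop) : Prop :=
  exists f : nat -> G, forall x : G, exists k : nat, T (x - f k).

Definition p_component (p : nat) (T : G -> Prop) : G -> Prop :=
  fun x => T x /\ exists k : nat, x *+ (p ^ k) = 0.

Definition independent (X : G -> Prop) : Prop :=
  forall (s : seq G) (c : G -> int), uniq s -> (forall x, x \in s -> X x) ->
    \sum_(x <- s) x *~ c x = 0 -> forall x, x \in s -> x *~ c x = 0.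

Definition in_span (X : G -> Prop) (y : G) : Prop :=
  exists (s : seq G) (c : G -> int), (forall x, x \in s -> X x) /\
    y = \sum_(x <- s) x *~ c x.

(* B is a direct sum of cyclic groups: B is (internally) the direct sum of
   the cyclic subgroups generated by an independent generating set X *)
Definition direct_sum_of_cyclic (B : G -> Prop) : Prop :=
  exists X : G -> Prop, independent X /\ (forall y, B y <-> in_span X y).

Definition pure_in (B A : G -> Prop) : Prop :=
  forall (n : nat) (b : G), B b -> (exists a, A a /\ a *+ n = b) ->
    exists b', B b' /\ b' *+ n = b.

Definition quotient_divisible (A B : G -> Prop) : Prop :=
  forall (a : G) (n : nat), A a -> (0 < n)%N ->
    exists a', A a' /\ B (a - a' *+ n).

Definition basic_subgroup (B A : G -> Prop) : Prop :=
  subgroup_of B A /\ direct_sum_of_cyclic B /\ pure_in B A /\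
  quotient_divisible A B.

Definition is_hom (f : G -> G) : Prop := forall x y, f (x - y) = f x - f y.

End AbelianGroups.

(* Main.v *)
From mathcomp Require Import all_boot all_algebra all_classical.
Require Import Defs.
Set Implicit Arguments. Unset Strict Implicit. Unset Printing Implicit Defensive.
Import GRing.Theory.
Local Open Scope ring_scope.

(** Let [X] be an independent generating set of [Bp], let [x] in [X] have order
    [p ^ nu x], and let [x_0, x_1, ...] represent the cosets of [T].  For an
    injection [gam : X -> X] with [nu j <= nu (gam j)], each [j] in [X] gives a
    homomorphism [F j : G -> <j>] sending [gam j] to [j] and killing the rest of
    [X]: as [Bp] is pure in [G], this is consistent modulo [p ^ nu j G], and a
    cyclic subgroup of maximal order in a bounded group is a summand.  The sum of the [F j] is onto [Bp], provided it is locally finite.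
    - On torsion elements local finiteness holds if [2 * nu j <= nu (gam j)]
      outside a set of [j] of bounded order.
    - [F j] can moreover be made to vanish on [x_0, ..., x_(K-1)] unless [gam j]
      lies in a finite set [U (K, nu j)], because [<x_0, ..., x_(K-1)>] is finite
      modulo [p ^ nu j G].
    By Zorn's lemma, [X] is the union of a set of bounded order, where [gam] is the
    identity, and of a set carrying an injection that doubles [nu] and avoids
    prescribed finite sets: an unbounded remainder contains a sequence along which
    [gam] can be taken to be the shift. *)

(** * Subgroups, their sums, and spans *)

Lemma subgroup0 (G : zmodType) (H : G -> Prop) : is_subgroup H -> H 0.
Proof. by case. Qed.

Lemma subgroupB (G : zmodType) (H : G -> Prop) x y :
  is_subgroup H -> H x -> H y -> H (x - y).
Proof. by case=> _; apply. Qed.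

Lemma subgroupN (G : zmodType) (H : G -> Prop) x : is_subgroup H -> H x -> H (- x).
Proof. by move=> sH Hx; rewrite -sub0r; apply: subgroupB => //; apply: subgroup0. Qed.

Lemma subgroupD (G : zmodType) (H : G -> Prop) x y :
  is_subgroup H -> H x -> H y -> H (x + y).
Proof. by move=> sH Hx Hy; rewrite -[y]opprK; apply: subgroupB => //; apply: subgroupN. Qed.

Lemma subgroupMn (G : zmodType) (H : G -> Prop) x n : is_subgroup H -> H x -> H (x *+ n).
Proof.
move=> sH Hx; elim: n => [|n IH]; first by rewrite mulr0n; apply: subgroup0.
by rewrite mulrS; apply: subgroupD.
Qed.

Lemma subgroupMz (G : zmodType) (H : G -> Prop) x (z : int) :
  is_subgroup H -> H x -> H (x *~ z).
Proof.
move=> sH Hx; case: z => n; first exact: subgroupMn.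
by rewrite NegzE mulrNz; apply: subgroupN => //; apply: subgroupMn.
Qed.

Lemma subgroup_sum (G : zmodType) (H : G -> Prop) (I : Type) (r : seq I) (F : I -> G) :
  is_subgroup H -> (forall i, H (F i)) -> H (\sum_(i <- r) F i).
Proof.
move=> sH HF; elim: r => [|i r IH]; first by rewrite big_nil; apply: subgroup0.
by rewrite big_cons; apply: subgroupD.
Qed.

Definition sum_subgroup (G : zmodType) (H K : G -> Prop) (y : G) : Prop :=
  exists h k, [/\ H h, K k & y = h + k].

Definition multiples (G : zmodType) (n : nat) (y : G) : Prop := exists u, y = u *+ n.

Definition cyclic_subgroup (G : zmodType) (g y : G) : Prop := exists z : int, y = g *~ z.

Lemma sum_subgroupP (G : zmodType) (H K : G -> Prop) :
  is_subgroup H -> is_subgroup K -> is_subgroup (sum_subgroup H K).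
Proof.
move=> sH sK; split; first by exists 0, 0; rewrite addr0; split=> //; apply: subgroup0.
move=> _ _ [h [k [Hh Kk ->]]] [h' [k' [Hh' Kk' ->]]].
by exists (h - h'), (k - k'); split; [exact: subgroupB | exact: subgroupB | rewrite opprD addrACA].
Qed.

Lemma sum_subgroupl (G : zmodType) (H K : G -> Prop) x :
  is_subgroup K -> H x -> sum_subgroup H K x.
Proof. by move=> sK Hx; exists x, 0; rewrite addr0; split=> //; apply: subgroup0. Qed.

Lemma sum_subgroupr (G : zmodType) (H K : G -> Prop) x :
  is_subgroup H -> K x -> sum_subgroup H K x.
Proof. by move=> sH Kx; exists 0, x; rewrite add0r; split=> //; apply: subgroup0. Qed.

Lemma multiplesP (G : zmodType) n : is_subgroup (@multiples G n).
Proof.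
split; first by exists 0; rewrite mul0rn.
by move=> _ _ [u ->] [v ->]; exists (u - v); rewrite mulrnBl.
Qed.

Lemma cyclic_subgroupP (G : zmodType) (g : G) : is_subgroup (cyclic_subgroup g).
Proof.
split; first by exists 0; rewrite mulr0z.
by move=> _ _ [u ->] [v ->]; exists (u - v); rewrite mulrzBr.
Qed.

(** [in_span] allows repeated entries and [independent] does not, so repetitions are absorbed into
    the coefficients. A larger [r] also brings two combinations over one list. *)
Lemma sum_undup (G : zmodType) (s r : seq G) (c : G -> int) :
  uniq r -> {subset s <= r} ->
  \sum_(x <- s) x *~ c x = \sum_(x <- r) x *~ (c x * (count_mem x s)%:Z).
Proof.
move=> ur; elim: s => [|a s IH] sr.
  by rewrite big_nil big1 // => x _; rewrite mulr0 mulr0z.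
rewrite big_cons IH => [|x xs]; last by apply: sr; rewrite inE xs orbT.
have ar : a \in r by apply: sr; rewrite inE eqxx.
rewrite !(bigD1_seq a) //= eqxx addrA -mulrzDr PoszD mulrDr mulr1; congr (_ + _).
by apply: eq_bigr => x /negPf; rewrite eq_sym => ->.
Qed.

Lemma in_span_uniq (G : zmodType) (X : G -> Prop) y : in_span X y ->
  exists (s : seq G) (c : G -> int),
    [/\ uniq s, forall x, x \in s -> X x & y = \sum_(x <- s) x *~ c x].
Proof.
move=> [s [c [sX ->]]]; exists (undup s), (fun x => c x * (count_mem x s)%:Z).
split; [exact: undup_uniq | by move=> x; rewrite mem_undup; apply: sX |].
by apply: sum_undup; [exact: undup_uniq | move=> x; rewrite mem_undup].
Qed.

Lemma in_spanP (G : zmodType) (X : G -> Prop) : is_subgroup (in_span X).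
Proof.
split; first by exists [::], (fun=> 0); rewrite big_nil.
move=> _ _ [s [c [sX ->]]] [t [d [tX ->]]].
have ur := undup_uniq (s ++ t).
exists (undup (s ++ t)), (fun x => c x * (count_mem x s)%:Z - d x * (count_mem x t)%:Z); split.
  by move=> x; rewrite mem_undup mem_cat => /orP[/sX|/tX].
rewrite (sum_undup c ur) ?(sum_undup d ur); first last.
- by move=> x xs; rewrite mem_undup mem_cat xs.
- by move=> x xs; rewrite mem_undup mem_cat xs orbT.
by rewrite -sumrB; apply: eq_bigr => x _; rewrite mulrzBr.
Qed.

Lemma in_span_gen (G : zmodType) (X : G -> Prop) x : X x -> in_span X x.
Proof.
move=> Xx; exists [:: x], (fun=> 1); split; last by rewrite big_seq1 mulr1z.
by move=> y; rewrite inE => /eqP ->.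
Qed.

Lemma in_span_min (G : zmodType) (X H : G -> Prop) y :
  is_subgroup H -> (forall x, X x -> H x) -> in_span X y -> H y.
Proof.
move=> sH XH [s [c [sX ->]]]; rewrite big_seq.
elim/big_ind: _ => [|u v|x xs]; [exact: subgroup0 | exact: subgroupD |].
by apply: subgroupMz => //; apply: XH; apply: sX.
Qed.

Definition punctured (G : zmodType) (X : G -> Prop) (g x : G) : Prop := X x /\ x <> g.

Lemma in_span_split (G : zmodType) (X : G -> Prop) (g b : G) : in_span X b ->
  exists z r, in_span (punctured X g) r /\ b = g *~ z + r.
Proof.
move=> /in_span_min-/(_ (sum_subgroup (cyclic_subgroup g) (in_span (punctured X g)))) [].
- by apply: sum_subgroupP; [exact: cyclic_subgroupP | exact: in_spanP].
- move=> x Xx; have [->|/eqP xg] := eqVneq x g.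
    by apply: sum_subgroupl; [exact: in_spanP | exists 1; rewrite mulr1z].
  by apply: sum_subgroupr; [exact: cyclic_subgroupP | exact: in_span_gen].
by move=> _ [r [[z ->] rX ->]]; exists z, r.
Qed.

(** Moving [g *~ z] across gives a relation over [g :: s] with coefficient [- z] at [g], which
    independence annihilates term by term. *)
Lemma independent_cyclic (G : zmodType) (X : G -> Prop) (g : G) (z : int) :
  independent X -> X g -> in_span (punctured X g) (g *~ z) -> g *~ z = 0.
Proof.
move=> indX Xg /in_span_uniq [s [c [us sX eqz]]].
have gs : g \notin s by apply/negP => /sX [_].
pose d x := if x == g then - z else c x.
have dg : d g = - z by rewrite /d eqxx.
suff : g *~ d g = 0 by rewrite dg mulrNz => /eqP; rewrite oppr_eq0 => /eqP.
apply: (indX (g :: s)) => [|x|| ]; rewrite ?inE ?eqxx //=; first by rewrite gs us.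
  by case/orP => [/eqP -> //|/sX []].
rewrite big_cons dg mulrNz eqz addrC; apply/eqP; rewrite subr_eq0; apply/eqP.
by rewrite !big_seq; apply: eq_bigr => x xs; rewrite /d; case: eqP xs gs => // -> ->.
Qed.

(** * Orders of elements of [p]-power torsion *)

Definition has_exponent (G : zmodType) (p : nat) (x : G) (n : nat) : Prop :=
  forall z : int, x *~ z = 0 <-> ((p ^ n)%N%:Z %| z)%Z.

(** Take the least [n] with [x *+ (p ^ n) = 0]. If [z] kills [x], so does its gcd with [p ^ n], by
    Bezout; this is a power of [p], hence [p ^ n] itself by minimality. *)
Lemma has_exponent_exists (G : zmodType) (p k : nat) (x : G) :
  prime p -> x *+ (p ^ k) = 0 -> exists n, has_exponent p x n.
Proof.
move=> pp xk; have ex : exists n, x *+ (p ^ n) == 0 by exists k; rewrite xk.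
exists (ex_minn ex); case: ex_minnP => n /eqP xn min z; split; last first.
  by case/dvdzP => u ->; rewrite mulrC mulrzA -pmulrn xn mul0rz.
move=> xz; have [u [v uv]] := Bezoutz z (p ^ n)%N.
have xg : x *~ gcdz z (p ^ n)%N = 0.
  by rewrite -uv mulrzDr [u * z]mulrC [v * _]mulrC !mulrzA xz -pmulrn xn !mul0rz addr0.
have /(dvdn_pfactor _ _ pp) [m mn gm] : (gcdn `|z| (p ^ n) %| p ^ n)%N by apply: dvdn_gcdr.
have nm : (n <= m)%N by apply: min; rewrite -gm pmulrn; apply/eqP.
rewrite dvdzE /= (_ : n = m) -?gm ?dvdn_gcdl //.
by apply/eqP; rewrite eqn_leq nm mn.
Qed.

(** * Maximal subgroups by Zorn's lemma *)

Lemma chain_pair (T : Type) (F : set (set T)) (A B : set T) :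
  total_on F subset -> F A -> F B -> exists2 C, F C & (A `|` B `<=` C)%classic.
Proof.
move=> totF FA FB; have [AB|BA] := totF _ _ FA FB.
  by exists B => // x [/AB|].
by exists A => // x [|/BA].
Qed.

Lemma maximal_subgroup_such_that (G : zmodType) (H : G -> Prop) (Q : (G -> Prop) -> Prop) :
  is_subgroup H -> Q H ->
  (forall F : set (set G), (exists M, F M) -> total_on F subset ->
     (forall M, F M -> Q M) -> Q (\bigcup_(M in F) M)%classic) ->
  exists M : G -> Prop, [/\ is_subgroup M, forall x, H x -> M x, Q M &
    forall M' : G -> Prop, is_subgroup M' -> Q M' -> (forall x, M x -> M' x) ->
      forall x, M' x -> M x].
Proof.
move=> sH QH Qcup.
pose good (M : set G) := [/\ is_subgroup M, (forall x, H x -> M x) & Q M].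
have goodH : good H by [].
have [F FP totF|M [PM maxM]] := @Zorn_bigcup G (fun M => M = set0 \/ good M).
  have [[M0 FM0 gM0]|none] := pselect (exists2 M, F M & good M); last first.
    left; apply/seteqP; split=> x // [M FM Mx].
    by case: (FP M FM) => [M0|gM]; [rewrite M0 in Mx | case: none; exists M].
  right; pose F' M := F M /\ good M.
  have -> : (\bigcup_(M in F) M = \bigcup_(M in F') M)%classic.
    apply/seteqP; split=> x [M FM Mx]; last by exists M => //; case: FM.
    by exists M => //; split=> //; case: (FP M FM) Mx => [->|].
  have totF' : total_on F' subset by move=> A B [FA _] [FB _]; apply: totF.
  split.
  - split; first by exists M0 => //; case: gM0 => /subgroup0.
    move=> x y [A FA Ax] [B FB By]; have [C FC ABC] := chain_pair totF' FA FB.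
    exists C => //; case: FC => _ [sC _ _].
    by apply: subgroupB => //; apply: ABC; [left | right].
  - by move=> x Hx; exists M0 => //; case: gM0 => _ /(_ x Hx).
  - by apply: Qcup => //; [exists M0 | move=> M [_ []]].
have [M0|gM] := PM.
  case: (maxM H); last by right.
  by rewrite M0; split=> // /(_ 0) H0; apply: H0; apply: subgroup0.
exists M; case: gM => sM HM QM; split=> // M' sM' QM' MM' x M'x.
apply: contrapT => nMx; apply: (maxM M'); last by right; split=> // y /HM /MM'.
by split=> // /(_ x M'x).
Qed.

(** * Homomorphisms onto cyclic groups *)

(** Modulo [H] the group is bounded by [p ^ n] and [g] has that maximal order. For [M] maximal with
    the divisibility property, [M + <g>] contains all multiples of [p ^ n] and is closed under
    division by [p], so it is all of [G]. *)
Lemma complement_exists (G : zmodType) (p n : nat) (H : G -> Prop) (g : G) :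
  prime p -> is_subgroup H -> (forall u, H (u *+ (p ^ n))) ->
  (forall z : int, H (g *~ z) -> ((p ^ n)%N%:Z %| z)%Z) ->
  exists M : G -> Prop, [/\ is_subgroup M, forall x, H x -> M x,
    forall z : int, M (g *~ z) -> ((p ^ n)%N%:Z %| z)%Z &
    forall x, exists z : int, M (x - g *~ z)].
Proof.
move=> pp sH Hp Hg.
have [|M [sM HM Mg maxM]] := maximal_subgroup_such_that
  (Q := fun M => forall z : int, M (g *~ z) -> ((p ^ n)%N%:Z %| z)%Z) sH Hg.
  by move=> F _ _ FQ z [M FM Mz]; apply: (FQ M).
exists M; split=> //.
have Mp u : M (u *+ (p ^ n)) by apply/HM/Hp.
case: n => [|n] in Hp Hg Mg maxM Mp *.
  by move=> x; exists 0; rewrite mulr0z subr0; have := Mp x; rewrite expn0 mulr1n.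
have sMg : is_subgroup (sum_subgroup M (cyclic_subgroup g)).
  by apply: sum_subgroupP => //; apply: cyclic_subgroupP.
have step x : (exists z : int, M (x *+ p - g *~ z)) -> exists z : int, M (x - g *~ z).
  move=> [z Mz].
  (* Multiplying by [p ^ n] sends [x *+ p] into [M]; hence [p ^ n.+1] divides [z * p ^ n], so [p]
     divides [z], and [x] can be corrected to [x'] with [x' *+ p] in [M]. *)
  have : M (g *~ (z * (p ^ n)%N)).
    have := subgroupMn (p ^ n) sM Mz; rewrite mulrnBl -mulrnA -expnS => Mz'.
    have := subgroupB sM (Mp x) Mz'; rewrite opprB addrC subrK.
    by rewrite mulrzA -pmulrn.
  move=> /Mg; rewrite expnS PoszM dvdz_mul2r; last by rewrite eqz_nat -lt0n expn_gt0 prime_gt0.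
  case/dvdzP => z' zE; pose x' := x - g *~ z'.
  have px' : M (x' *+ p) by rewrite /x' mulrnBl [g *~ z' *+ p]pmulrn -mulrzA -zE.
  suff [m [_ [Mm [a ->] x'E]]] : sum_subgroup M (cyclic_subgroup g) x'.
    exists (z' + a); rewrite mulrzDr opprD addrA -/x' x'E addrK //.
  pose M' := sum_subgroup M (cyclic_subgroup x').
  have sM' : is_subgroup M' by apply: sum_subgroupP => //; apply: cyclic_subgroupP.
  have MM' y : M y -> M' y by apply: sum_subgroupl; apply: cyclic_subgroupP.
  have M'x' : M' x' by apply: sum_subgroupr => //; exists 1; rewrite mulr1z.
  (* Either [M'] is still admissible and maximality puts [x'] in [M], or some [g *~ w = m + x' *~ a]
     violates divisibility. Then [p] does not divide [a], and Bezout recovers [x'] from [x' *~ a]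
     and [x' *+ p]. *)
  have [M'Q|] := pselect (forall z : int, M' (g *~ z) -> ((p ^ n.+1)%N%:Z %| z)%Z).
    by apply: sum_subgroupl; [exact: cyclic_subgroupP | apply: maxM M'Q MM' _ M'x'].
  move=> /existsNP [w /not_implyP [[m [_ [Mm [a ->] wE]]] ndiv]].
  have [/dvdzP [b aE]|npa] := boolP (p%:Z %| a)%Z.
    case: ndiv; apply: Mg; rewrite wE; apply: subgroupD => //.
    by rewrite aE mulrC mulrzA -pmulrn; apply: subgroupMz.
  have [u [v uv]] := Bezoutz a p%:Z.
  have cop : gcdz a p = 1.
    by apply/eqP; rewrite -/(coprimez a p) coprimez_sym coprimezE /= prime_coprime.
  have -> : x' = (g *~ w - m) *~ u + x' *+ p *~ v.
    have -> : g *~ w - m = x' *~ a by rewrite wE [m + _]addrC addrK.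
    rewrite -mulrzA [_ *+ p]pmulrn -mulrzA -mulrzDr.
    by rewrite [a * u]mulrC [_ * v]mulrC uv cop mulr1z.
  apply: subgroupD => //; last first.
    by apply: sum_subgroupl; [exact: cyclic_subgroupP | exact: subgroupMz].
  apply: subgroupMz => //; apply: subgroupB => //.
    by apply: sum_subgroupr => //; exists w.
  by apply: sum_subgroupl => //; exact: cyclic_subgroupP.
move=> x; have : exists z : int, M (x *+ (p ^ n.+1) - g *~ z).
  by exists 0; rewrite mulr0z subr0.
elim: n.+1 {Hp Hg Mg maxM Mp} => [|k IH]; first by rewrite expn0 mulr1n.
by rewrite expnSr mulrnA => /step.
Qed.

(** This is the projection along [M]. The coefficient of [g] is unique only modulo [p ^ n], which
    suffices because [e] has order [p ^ n]; [g] itself may have larger order. *)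
Lemma cyclic_hom (G : zmodType) (p n : nat) (H : G -> Prop) (g e : G) :
  prime p -> is_subgroup H -> (forall u, H (u *+ (p ^ n))) ->
  (forall z : int, H (g *~ z) -> ((p ^ n)%N%:Z %| z)%Z) -> has_exponent p e n ->
  exists f : G -> G, [/\ is_hom f, forall x, cyclic_subgroup e (f x), f g = e &
    forall x, H x -> f x = 0].
Proof.
move=> pp sH Hp Hg en; have [M [sM HM Mg Mgen]] := complement_exists pp sH Hp Hg.
have [zeta Mz] := choice Mgen.
have eqe (a b : int) : M (g *~ (a - b)) -> e *~ a = e *~ b.
  by move=> /Mg /en; rewrite mulrzBr => /eqP; rewrite subr_eq0 => /eqP.
exists (fun x => e *~ zeta x); split.
- move=> x y; rewrite -mulrzBr; apply: eqe.
  have := subgroupB sM (subgroupB sM (Mz x) (Mz y)) (Mz (x - y)).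
  have E (a b c d t : G) : a - b - (c - d) - (a - c - t) = t - (b - d).
    rewrite [in a - b - _]opprD addrACA -opprD.
    by rewrite [- (_ - t)]opprB [LHS]addrC addrA subrK.
  by rewrite E !mulrzBr.
- by move=> x; exists (zeta x).
- rewrite -[RHS]mulr1z; apply: eqe; have := subgroupN sM (Mz g).
  by rewrite mulrzBr mulr1z opprB.
- move=> x Hx; rewrite -[RHS](mulr0z e); apply: eqe; rewrite subr0.
  by have := subgroupB sM (HM _ Hx) (Mz x); rewrite opprB addrC subrK.
Qed.

(** * Finite obstruction to killing given elements *)

Lemma finite_residues (G : zmodType) (N : nat) (s : seq G) : (0 < N)%N ->
  exists L : seq G, forall w, in_span (fun y => y \in s) w ->
    exists l u, l \in L /\ w = l + u *+ N.
Proof.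
move=> N0; elim: s => [|a s [L HL]].
  exists [:: 0] => w ws; exists 0, 0; rewrite mem_head mul0rn addr0; split=> //.
  apply: (in_span_min (H := fun y => y = 0)) ws => [|x]; last by rewrite in_nil.
  by split=> // x y -> ->; rewrite subr0.
exists [seq l + a *+ i | l <- L, i <- iota 0 N] => w /(in_span_split a) [z [r [rs ->]]].
have [|l [u [lL rE]]] := HL r.
  apply: in_span_min rs => [|x [xs xa]]; first exact: in_spanP.
  by apply: in_span_gen; move: xs; rewrite inE => /orP[/eqP|].
have [i iN zi] : exists2 i : nat, (i < N)%N & (z %% N%:Z)%Z = i.
  have z0 : (0 <= (z %% N%:Z)%Z)%R by rewrite modz_ge0 // eqz_nat -lt0n.
  have := ltz_pmod z (d := N%:Z); rewrite ltz_nat => /(_ N0).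
  by case: (z %% N%:Z)%Z z0 => // i _ iN; exists i.
exists (l + a *+ i), (u + a *~ (z %/ N)%Z); split.
  by apply/allpairsP; exists (l, i); rewrite mem_iota.
rewrite {1}(divz_eq z N) zi mulrzDr mulrzA -pmulrn rE mulrnDl -pmulrn.
by rewrite [X in X + _ = _]addrC addrACA [a *+ i + l]addrC [_ *+ N + _ *+ N]addrC.
Qed.

Definition pure_at (G : zmodType) (X : G -> Prop) (N : nat) : Prop :=
  forall b u : G, in_span X b -> u *+ N = b -> exists2 b', in_span X b' & b' *+ N = b.

(* [z] is only determined modulo the order of [g], hence the conclusion on multiples of [g]. *)
Lemma pure_coefficient (G : zmodType) (X : G -> Prop) (N : nat) (g r u : G) (z : int) :
  independent X -> pure_at X N -> X g ->
  in_span (punctured X g) r -> g *~ z + r = u *+ N ->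
  exists z' : int, g *~ z = g *~ (z' * N%:Z).
Proof.
move=> indX pureX Xg rX E.
have sub y : in_span (punctured X g) y -> in_span X y.
  by apply: in_span_min => [|x []]; [exact: in_spanP | move=> Xx _; apply: in_span_gen].
(* Purity replaces [u] by an element [b] of the span; [z'] is its coefficient at [g], and
   independence compares the two sides. *)
have [||b bX bE] := pureX (g *~ z + r) u.
- apply: subgroupD; [exact: in_spanP | | exact: sub].
  by apply: subgroupMz; [exact: in_spanP | exact: in_span_gen].
- by rewrite E.
have [z' [r' [r'X bE']]] := in_span_split g bX; exists z'.
apply/eqP; rewrite -subr_eq0 -mulrzBr; apply/eqP.
apply: (independent_cyclic indX Xg); suff -> : g *~ (z - z' * N%:Z) = r' *+ N - r.
  apply: subgroupB => //; [exact: in_spanP | apply: subgroupMn => //; exact: in_spanP].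
move: bE; rewrite bE' mulrnDl => E2.
apply/eqP; rewrite mulrzBr mulrzA -pmulrn subr_eq addrAC.
by rewrite [_ *+ N + _]addrC E2 addrK.
Qed.

(** Modulo [N], [w] is one of finitely many [l]. For each [l] fix one [b l] in the span of [X] with
    [b l + l] divisible by [N], if there is any; [U] collects their supports. For [g] outside [U],
    subtracting [b l + l] removes [w] without touching the coefficient of [g]. *)
Lemma finite_obstruction (G : zmodType) (X : G -> Prop) (N : nat) (s : seq G) :
  independent X -> pure_at X N -> (0 < N)%N ->
  exists U : seq G, forall (g r w u : G) (z : int), X g -> g \notin U ->
    in_span (punctured X g) r -> in_span (fun y => y \in s) w ->
    g *~ z + r + w = u *+ N -> exists z' : int, g *~ z = g *~ (z' * N%:Z).
Proof.
move=> indX pureX N0; have [L HL] := finite_residues s N0.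
pose hit l b := in_span X b /\ exists u, b + l = u *+ N.
have /choice [b Hb] : forall l, exists b, (exists b', hit l b') -> hit l b.
  move=> l; have [[b' hb']|nh] := pselect (exists b', hit l b'); first by exists b'.
  by exists 0 => /nh.
have /choice [S HS] : forall l, exists S : seq G, in_span X (b l) ->
    forall g, g \notin S -> in_span (punctured X g) (b l).
  move=> l; have [[S [c [SX E]]]|nb] := pselect (in_span X (b l)); last by exists [::].
  exists S => _ g gS; exists S, c; split=> // x xS; split; first exact: SX.
  by move=> xg; rewrite -xg xS in gS.
exists (flatten (map S L)) => g r w u z Xg gU rX ws E.
have [l [v [lL wE]]] := HL w ws.
have [|blX [v' blE]] := Hb l.
  exists (g *~ z + r); split.
    apply: subgroupD; first exact: in_spanP.
      by apply: subgroupMz; [exact: in_spanP | exact: in_span_gen].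
    apply: in_span_min rX => [|x [Xx _]]; [exact: in_spanP | exact: in_span_gen].
  by exists (u - v); rewrite mulrnBl -E wE [l + _]addrC !addrA addrAC addrK.
have {}blX : in_span (punctured X g) (b l).
  apply: HS => //; apply: contraNN gU => gS; apply/flatten_mapP; by exists l.
apply: (@pure_coefficient _ X N g (r - b l) (u - v - v')) => //.
  by apply: subgroupB => //; exact: in_spanP.
by rewrite !mulrnBl -blE -E wE [_ + (l + _)]addrA addrK [b l + l]addrC opprD !addrA addrK.
Qed.

(** * The injection [gam] *)

Lemma matching (T : eqType) (X : T -> Prop) (nu : T -> nat) (V : nat -> seq T) :
  exists (m : nat) (gam : T -> T), [/\ forall x, X x -> X (gam x),
    forall x y, X x -> X y -> gam x = gam y -> x = y &
    forall x, X x -> (gam x = x /\ (nu x <= m)%N) \/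
      ((nu x).*2 < nu (gam x))%N /\ gam x \notin V (nu x)].
Proof.
pose R d g := [/\ X d, X g, ((nu d).*2 < nu g)%N & g \notin V (nu d)].
(* The last clause puts the range of [Phi] inside its domain, so extending by the identity, or by a
   sequence outside the domain, preserves injectivity. *)
pose P (Phi : set (T * T)) := [/\ forall a b, Phi (a, b) -> R a b,
  forall a b c, Phi (a, b) -> Phi (a, c) -> b = c,
  forall a b c, Phi (a, c) -> Phi (b, c) -> a = b &
  forall a b, Phi (a, b) -> exists c, Phi (b, c)].
have [F FP totF|Phi [[PR Pfun Pinj Pdom] maxPhi]] := @Zorn_bigcup _ P.
  split.
  - by move=> a b [A /FP [AR _ _ _] /AR].
  - move=> a b c [A FA Aab] [B FB Bac]; have [C FC ABC] := chain_pair totF FA FB.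
    by have [_ Cf _ _] := FP C FC; apply: (Cf a); apply: ABC; [left|right].
  - move=> a b c [A FA Aac] [B FB Bbc]; have [C FC ABC] := chain_pair totF FA FB.
    by have [_ _ Ci _] := FP C FC; apply: (Ci _ _ c); apply: ABC; [left|right].
  - by move=> a b [A FA Aab]; have [_ _ _ /(_ a b Aab) [c Ac]] := FP A FA; exists c, A.
pose D a := exists b, Phi (a, b).
have [[m Hm]|unb] := pselect (exists m, forall x, X x -> ~ D x -> (nu x <= m)%N).
  have /choice [gam Hgam] : forall x, exists y, Phi (x, y) \/ (~ D x /\ y = x).
    by move=> x; have [[y xy]|nD] := pselect (D x); [exists y; left | exists x; right].
  exists m, gam; split.
  - by move=> x Xx; case: (Hgam x) => [/PR []|[_ ->]].
  - move=> x y Xx Xy; case: (Hgam x) => [xg|[nDx ->]]; case: (Hgam y) => [yg|[nDy ->]] // E.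
    + by apply: Pinj yg; rewrite -E.
    + by case: nDy; rewrite -E; apply: Pdom xg.
    + by case: nDx; rewrite E; apply: Pdom yg.
  - move=> x Xx; case: (Hgam x) => [/PR []|[nD E]]; first by right.
    by left; split=> //; apply: Hm.
have big m : exists x, [/\ X x, ~ D x & (m < nu x)%N].
  apply: contrapT => no; apply: unb; exists m => x Xx nDx.
  by rewrite leqNgt; apply/negP => mx; apply: no; exists x.
have /choice [h Hh] : forall d, exists g,
    [/\ X g, ~ D g, ((nu d).*2 < nu g)%N & g \notin V (nu d)].
  (* Exceeding every [nu x] with [x] in [V (nu d)] keeps [g] out of that list. *)
  move=> d; have [g [Xg nDg gm]] := big (maxn (nu d).*2 (\max_(x <- V (nu d)) nu x)).
  exists g; split=> //; first by apply: leq_ltn_trans gm; exact: leq_maxl.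
  apply/negP => gV; move: gm; rewrite ltnNge => /negP; apply.
  by rewrite leq_max; apply/orP; right; apply: leq_bigmax_seq.
have [y0 [Xy0 nDy0 _]] := big 0%N.
pose y i := iter i h y0.
have Xy i : X (y i) by case: i => [|i] //=; case: (Hh (y i)).
have nDy i : ~ D (y i) by case: i => [|i] //=; case: (Hh (y i)).
have yS i : (nu (y i) < nu (y i.+1))%N.
  by case: (Hh (y i)) => _ _ /(leq_ltn_trans _) yy _; apply: yy; rewrite -addnn leq_addr.
have yinj : injective y.
  have ymono i j : (i < j)%N -> (nu (y i) < nu (y j))%N.
    apply: (homo_ltn (r := fun a b => nu a < nu b)%N) => [b a c|k]; last exact: yS.
    exact: ltn_trans.
  by move=> i j E; case: (ltngtP i j) => // /ymono; rewrite E ltnn.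
(* Adjoining the shift along [y] contradicts the maximality of [Phi]. *)
pose Psi ab := Phi ab \/ exists i, ab = (y i, y i.+1).
case: (maxPhi Psi).
  split=> [ab|sub]; first by left.
  by apply: (nDy 0%N); exists (y 1%N); apply: sub; right; exists 0%N.
split.
- move=> a b [/PR //|[i [-> ->]]]; split=> //; by case: (Hh (y i)).
- move=> a b c [ab|[i [ai bi]]] [ac|[j [aj cj]]].
  + exact: Pfun ab ac.
  + by case: (nDy j); rewrite -aj; exists b.
  + by case: (nDy i); rewrite -ai; exists c.
  + have ij : i = j by apply: yinj; rewrite -ai.
    by rewrite bi cj ij.
- move=> a b c [ac|[i [ai ci]]] [bc|[j [bj cj]]].
  + exact: Pinj ac bc.
  + by have := Pdom _ _ ac; rewrite cj => /(nDy j.+1).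
  + by have := Pdom _ _ bc; rewrite ci => /(nDy i.+1).
  + have [ij] : i.+1 = j.+1 by apply: yinj; move: cj; rewrite ci.
    by rewrite ai bj ij.
- move=> a b [/Pdom [c bc]|[i [_ ->]]]; first by exists c; left.
  by exists (y i.+2); right; exists i.+1.
Qed.

(** * Locally finite sums of homomorphisms *)

Lemma sum_support_widen (G : zmodType) (F : G -> G) (r s : seq G) :
  uniq r -> uniq s -> {subset r <= s} -> (forall j, j \notin r -> F j = 0) ->
  \sum_(j <- r) F j = \sum_(j <- s) F j.
Proof.
move=> ur us rs F0; rewrite [RHS](bigID (mem r)) /= [X in _ + X]big1 // addr0.
rewrite -[RHS]big_filter; apply: perm_big; apply: uniq_perm => //; first exact: filter_uniq.
by move=> x; rewrite mem_filter; apply/idP/andP => [xr|[]//]; split=> //; apply: rs.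
Qed.

(** Any list containing the support gives the same value, so additivity is checked on one list
    common to [x], [y] and [x - y]. *)
Lemma locally_finite_sum (G : zmodType) (F : G -> G -> G) :
  (forall j, is_hom (F j)) ->
  (forall x, exists s : seq G, forall j, j \notin s -> F j x = 0) ->
  exists f : G -> G, is_hom f /\ forall x (r : seq G), uniq r ->
    (forall j, j \notin r -> F j x = 0) -> f x = \sum_(j <- r) F j x.
Proof.
move=> homF /choice [s Hs].
pose f x := \sum_(j <- undup (s x)) F j x.
have fE x (r : seq G) : uniq r -> (forall j, j \notin r -> F j x = 0) ->
    f x = \sum_(j <- r) F j x.
  move=> ur Hr; have us := undup_uniq (s x ++ r).
  transitivity (\sum_(j <- undup (s x ++ r)) F j x).
    apply: sum_support_widen; rewrite ?undup_uniq // => j.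
      by rewrite !mem_undup mem_cat => ->.
    by rewrite mem_undup; apply: Hs.
  by apply/esym/sum_support_widen => // j jr; rewrite mem_undup mem_cat jr orbT.
exists f; split=> // x y.
pose r := undup (s x ++ (s y ++ s (x - y))).
have ur : uniq r by exact: undup_uniq.
rewrite !(fE _ r) -?sumrB //; first by apply: eq_bigr => j _; apply: homF.
all: by move=> j; rewrite mem_undup !mem_cat !negb_or => /and3P [? ? ?]; apply: Hs.
Qed.

(** * Local finiteness on primary elements *)

(** For [nu j <= N] one decomposition of [a] modulo [p ^ N] serves all [j], and [s] is its support.
    For larger [nu j] no exception occurs, thanks to the doubling of [nu]. *)
Lemma primary_support (G : zmodType) (A X : G -> Prop) (p m k : nat) (nu : G -> nat)
    (gam : G -> G) (a : G) :
  prime p -> independent X -> (forall n, pure_at X (p ^ n)) ->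
  (forall (a : G) n, A a -> exists c, in_span X (a - c *+ (p ^ n))) ->
  (forall x, X x -> has_exponent p x (nu x)) -> (forall x, X x -> X (gam x)) ->
  (forall x, X x -> (nu x <= m)%N \/ ((nu x).*2 <= nu (gam x))%N) ->
  A a -> a *+ (p ^ k) = 0 ->
  exists s : seq G, forall j, X j -> gam j \notin s ->
    sum_subgroup (in_span (punctured X (gam j))) (multiples (p ^ nu j)) a.
Proof.
move=> pp indX pureX divX nuP Xgam gamP Aa ak; pose N := maxn k m.
have [c [s [d [sX bE]]]] := divX a N Aa; exists s => j Xj js.
have [nN|Nn] := leqP (nu j) N.
  exists (a - c *+ (p ^ N)), (c *+ (p ^ N)); rewrite subrK; split=> //; last first.
    by exists (c *+ (p ^ (N - nu j))); rewrite -mulrnA -expnD subnK.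
  exists s, d; split=> // x xs; split; first exact: sX.
  by move=> xj; rewrite -xj xs in js.
have small : ((nu j).*2 <= nu (gam j))%N.
  by case: (gamP j Xj) => // jm; move: Nn; rewrite ltnNge leq_max jm orbT.
have kn : (k <= nu j)%N by apply: leq_trans (ltnW Nn); exact: leq_maxl.
have [c' b'X] := divX a (nu j) Aa; set b' := a - _ in b'X.
(* Since [p ^ k] kills [a], [b' *+ (p ^ k)] is divisible by [p ^ (k + nu j)]; purity yields [b'']
   such that [p ^ k] kills [b' - b'' *+ (p ^ nu j)]. *)
have [||b'' b''X b''E] := pureX (k + nu j)%N (b' *+ (p ^ k)) (- c').
- by apply: subgroupMn => //; exact: in_spanP.
- by rewrite /b' mulrnBl ak sub0r -mulrnA -expnD addnC mulNrn.
have : in_span X (b' - b'' *+ (p ^ nu j)).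
  by apply: subgroupB => //; [exact: in_spanP | apply: subgroupMn => //; exact: in_spanP].
move=> /(in_span_split (gam j)) [z [r [rX zr]]].
have /eqP : gam j *~ (z * (p ^ k)%N%:Z) + r *+ (p ^ k) = 0.
  by rewrite mulrzA -pmulrn -mulrnDl -zr mulrnBl -mulrnA -expnD addnC b''E subrr.
rewrite addr_eq0 => /eqP zk.
have : gam j *~ (z * (p ^ k)%N%:Z) = 0.
  apply: (independent_cyclic indX (Xgam j Xj)); rewrite zk.
  apply: subgroupN; first exact: in_spanP.
  by apply: subgroupMn => //; exact: in_spanP.
move=> /(nuP _ (Xgam j Xj)) zdiv.
(* Here [k + nu j <= (nu j).*2 <= nu (gam j)], and [p ^ k] is cancelled. *)
have /dvdzP [q qE] : ((p ^ nu j)%N%:Z %| z)%Z.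
  rewrite -(@dvdz_mul2r (p ^ k)%N%:Z); last first.
    by rewrite eqz_nat -lt0n expn_gt0 prime_gt0.
  apply: dvdz_trans zdiv; rewrite -PoszM -expnD dvdzE /=; apply: dvdn_exp2l.
  by apply: leq_trans small; rewrite -addnn leq_add2l.
exists r, (gam j *~ z + (c' + b'') *+ (p ^ nu j)); split=> //.
  by exists (gam j *~ q + (c' + b'')); rewrite qE mulrzA -pmulrn -mulrnDl.
rewrite addrA [r + _]addrC -zr mulrnDl.
by rewrite addrA addrAC subrK subrK.
Qed.

Lemma is_hom_additive (G : zmodType) (f : G -> G) : is_hom f ->
  [/\ f 0 = 0, forall x y, f (x + y) = f x + f y & forall x n, f (x *+ n) = f x *+ n].
Proof.
move=> hf; have f0 : f 0 = 0 by rewrite -[X in f X](subrr 0) hf subrr.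
have fD x y : f (x + y) = f x + f y.
  by rewrite -[y in LHS]opprK hf -[- y]sub0r hf f0 sub0r opprK.
split=> // x n; elim: n => [|n IH]; first by rewrite !mulr0n.
by rewrite !mulrS fD IH.
Qed.

Lemma mulrn_coprime_eq0 (G : zmodType) (y : G) (m n : nat) :
  coprime m n -> y *+ m = 0 -> y *+ n = 0 -> y = 0.
Proof.
move=> mn ym yn; have [u [v uv]] := Bezoutz m n.
have g1 : gcdz m n = 1 by apply/eqP; rewrite -/(coprimez m n) coprimezE.
by rewrite -[y]mulr1z -g1 -uv mulrzDr ![_ * Posz _]mulrC !mulrzA -!pmulrn ym yn !mul0rz addr0.
Qed.

(** * Construction of the surjection *)

Theorem theorem3p1 (G : zmodType) (T : G -> Prop) (p : nat) (Bp : G -> Prop) :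
  torsion_subgroup T ->
  quotient_countable T ->
  quotient_torsion_free T ->
  prime p ->
  basic_subgroup Bp (p_component p T) ->
  exists f : G -> G, is_hom f /\ (forall x, Bp (f x)) /\
    (forall b, Bp b -> exists x, f x = b).
Proof.
move=> [sT torT] [xk xkP] tfT pp [[sB BA] [[X [indX BX]] [pureB divB]]].
have XB x : X x -> Bp x by move=> Xx; apply/BX; exact: in_span_gen.
have pn0 n : (0 < p ^ n)%N by rewrite expn_gt0 prime_gt0.
(* A [p ^ n]-th root in [G] of an element of [Bp] lies in [T], as [G/T] is torsion-free, and hence
   in the [p]-component, where [Bp] is pure. *)
have pureX n : pure_at X (p ^ n).
  move=> b u /BX Bb ub; have [Tb [k bk]] := BA b Bb.
  have [|b' [Bb' b'E]] := pureB (p ^ n)%N b Bb; last by exists b' => //; apply/BX.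
  exists u; split=> //; split; first by apply: (tfT u (p ^ n)%N) => //; rewrite ub.
  by exists (n + k)%N; rewrite expnD mulrnA ub.
have divX (a : G) n : p_component p T a -> exists c, in_span X (a - c *+ (p ^ n)).
  by move=> Aa; have [c [_ /BX cX]] := divB a (p ^ n)%N Aa (pn0 n); exists c.
have /choice [nu nuP] : forall x, exists n, X x -> has_exponent p x n.
  move=> x; have [Xx|nX] := pselect (X x); last by exists 0%N.
  have [_ [k xp]] := BA x (XB x Xx).
  by have [n nP] := has_exponent_exists pp xp; exists n.
pose xs K := [seq xk k | k <- iota 0 K].
have /choice [U UP] := fun Kn : nat * nat =>
  finite_obstruction (xs Kn.1) indX (pureX Kn.2) (pn0 Kn.2).
pose V l := flatten [seq U (K, n) | K <- iota 0 l.+1, n <- iota 0 l.+1].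
have UV g K n l : (K <= l)%N -> (n <= l)%N -> g \notin V l -> g \notin U (K, n).
  move=> Kl nl; apply: contraNN => gU; apply/flattenP; exists (U (K, n)) => //.
  by apply/allpairsP; exists (K, n); rewrite !mem_iota.
have [m [gam [Xgam gam_inj gamP]]] := matching X nu V.
have nu_gam j : X j -> (nu j <= nu (gam j))%N.
  move=> Xj; case: (gamP j Xj) => [[-> _] //|[/ltnW gj _]].
  by apply: leq_trans gj; rewrite -addnn leq_addr.
(* [F j] is to kill the span of [xs K] for every [K] whose obstruction [gam j] avoids; [w = 0]
   covers the case of no such [K]. *)
pose W j w := w = 0 \/ exists K, gam j \notin V (maxn K (nu j)) /\
  in_span (fun y => y \in xs K) w.
have xs_mono K L w : (K <= L)%N -> in_span (fun y => y \in xs K) w ->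
    in_span (fun y => y \in xs L) w.
  move=> KL; apply: in_span_min => [|_ /mapP [k kK ->]]; first exact: in_spanP.
  apply: in_span_gen; apply: map_f; move: kK; rewrite !mem_iota /= => kK.
  exact: leq_trans KL.
have sW j : is_subgroup (W j).
  split=> [|x y]; first by left.
  case=> [->|[K [KV Kx]]]; case=> [->|[L [LV Ly]]].
  - by left; rewrite subr0.
  - by right; exists L; split=> //; rewrite sub0r; apply: subgroupN => //; exact: in_spanP.
  - by right; exists K; split=> //; rewrite subr0.
  - right; have [KL|/ltnW LK] := leqP K L.
      exists L; split=> //; apply: subgroupB => //; first exact: in_spanP.
      exact: xs_mono Kx.
    exists K; split=> //; apply: subgroupB => //; first exact: in_spanP.
    exact: xs_mono Ly.
pose H j := sum_subgroup (sum_subgroup (in_span (punctured X (gam j))) (W j))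
  (multiples (p ^ nu j)).
have sP j : is_subgroup (in_span (punctured X (gam j))) by exact: in_spanP.
have sPW j : is_subgroup (sum_subgroup (in_span (punctured X (gam j))) (W j)).
  exact: sum_subgroupP.
have sM j : is_subgroup (@multiples G (p ^ nu j)) by exact: multiplesP.
have sH j : is_subgroup (H j) by exact: sum_subgroupP.
have H_mult j u : H j (u *+ (p ^ nu j)) by apply: sum_subgroupr => //; exists u.
(* By the obstruction lemma [z] is a multiple of [p ^ nu j] up to the order of [gam j], itself
   divisible by [p ^ nu j] because [nu j <= nu (gam j)]. *)
have H_gam j (z : int) : X j -> H j (gam j *~ z) -> ((p ^ nu j)%N%:Z %| z)%Z.
  move=> Xj [_ [_ [[r [w [rX Ww ->]]] [u ->] zE]]].
  suff [z' z'E] : exists z' : int, gam j *~ z = gam j *~ (z' * (p ^ nu j)%N%:Z).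
    have /(nuP _ (Xgam j Xj)) : gam j *~ (z - z' * (p ^ nu j)%N%:Z) = 0.
      by rewrite mulrzBr z'E subrr.
    move=> /(dvdz_trans (n := (p ^ nu (gam j))%N%:Z)) zz.
    have : ((p ^ nu j)%N%:Z %| z - z' * (p ^ nu j)%N%:Z)%Z.
      by apply: zz; rewrite dvdzE /=; apply: dvdn_exp2l; exact: nu_gam.
    by move=> zd; rewrite -(subrK (z' * (p ^ nu j)%N%:Z) z) rpredD // dvdz_mull.
  have rNX : in_span (punctured X (gam j)) (- r) by exact: subgroupN.
  case: Ww => [w0|[K [KV wK]]].
    apply: (pure_coefficient indX (pureX (nu j)) (Xgam j Xj) rNX (u := u)).
    by rewrite zE w0 addr0 addrC addKr.
  apply: (UP (K, nu j) _ _ (- w) u z (Xgam j Xj) _ rNX).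
  - by apply: UV KV; rewrite ?leq_maxl ?leq_maxr.
  - by apply: subgroupN => //; exact: in_spanP.
  - by rewrite zE -addrA -opprD addrC addKr.
have /choice [F FP] : forall j, exists f : G -> G, [/\ is_hom f,
    X j -> [/\ forall x, cyclic_subgroup j (f x), f (gam j) = j & forall x, H j x -> f x = 0] &
    ~ X j -> forall x, f x = 0].
  move=> j; have [Xj|nXj] := pselect (X j); last first.
    by exists (fun=> 0); split=> // x y; rewrite subr0.
  have [f [hf fj fg fH]] :=
    cyclic_hom pp (sH j) (H_mult j) (fun z => @H_gam j z Xj) (nuP j Xj).
  by exists f; split.
have homF j : is_hom (F j) by case: (FP j).
have FH j x : X j -> H j x -> F j x = 0.
  by move=> Xj; have [_ /(_ Xj) [_ _ +] _] := FP j; apply.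
have FnX j x : ~ X j -> F j x = 0 by case: (FP j) => _ _ /[apply].
(* A left inverse of [gam] on [X] turns finite sets of values [gam j] into finite sets of indices
   [j]. *)
have /choice [ginv ginvP] : forall g, exists j, forall i, X i -> gam i = g -> i = j.
  move=> g; have [[j Xj jg]|no] := pselect (exists2 j, X j & gam j = g).
    by exists j => i Xi ig; apply: gam_inj => //; rewrite ig.
  by exists 0 => i Xi ig; case: no; exists i.
have pull (s : seq G) j : X j -> j \notin map ginv s -> gam j \notin s.
  move=> Xj; apply: contraNN => gs; apply/mapP; exists (gam j) => //.
  exact: ginvP.
have fin_x k : exists s : seq G, forall j, j \notin s -> F j (xk k) = 0.
  (* The first list handles [nu j <= k.+1]. For larger [nu j], a moved [gam j] avoids [V (nu j)] by
     construction, and a fixed one has [nu j <= m], so the second list handles it. *)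
  exists (map ginv (V k.+1) ++ flatten [seq V l | l <- iota 0 m.+1]) => j.
  rewrite mem_cat negb_or => /andP [jk jm].
  have [Xj|/FnX //] := pselect (X j); apply: FH => //.
  apply: sum_subgroupl => //; apply: sum_subgroupr => //; right; exists k.+1; split; last first.
    by apply: in_span_gen; apply: map_f; rewrite mem_iota add0n /=.
  have [_|_] := leqP (nu j) k.+1; first exact: pull.
  case: (gamP j Xj) => [[-> jm']|[] //]; apply: contraNN jm => jV.
  by apply/flatten_mapP; exists (nu j) => //; rewrite mem_iota.
have fin_t t : T t -> exists s : seq G, forall j, j \notin s -> F j t = 0.
  move=> Tt; have [n [n0 tn]] := torT t Tt.
  (* [t *+ n'] is [p]-primary, so [F j] kills it for almost all [j]; as [p ^ nu j] kills [F j t] and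
     is prime to [n'], [F j t] vanishes too. *)
  have [n' cop nE] := pfactor_coprime pp n0.
  have Aa : p_component p T (t *+ n').
    by split; [exact: subgroupMn | exists (logn p n); rewrite -mulrnA -nE].
  have [x Xx||s sP'] := primary_support (k := logn p n) (m := m) pp indX pureX divX nuP Xgam _ Aa.
  - by case: (gamP x Xx) => [[_ ?]|[/ltnW ? _]]; [left | right].
  - by rewrite -mulrnA -nE.
  exists (map ginv s) => j js; have [Xj|/FnX //] := pselect (X j).
  have [_ _ FMn] := is_hom_additive (homF j).
  apply: (@mulrn_coprime_eq0 _ _ (p ^ nu j) n').
  - by rewrite coprimeXl.
  - by rewrite -FMn; apply: FH.
  - rewrite -FMn; apply: FH => //.
    have [h [q [hX qM ->]]] := sP' j Xj (pull s j Xj js).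
    by exists h, q; split=> //; apply: sum_subgroupl.
have fin x : exists s : seq G, forall j, j \notin s -> F j x = 0.
  have [k /fin_t [s sP']] := xkP x; have [s' s'P] := fin_x k.
  exists (s ++ s') => j; rewrite mem_cat negb_or => /andP [js js'].
  have [_ FD _] := is_hom_additive (homF j).
  by rewrite -(subrK (xk k) x) FD sP' // s'P // addr0.
have [f [hf fE]] := locally_finite_sum homF fin.
have f_gam i : X i -> f (gam i) = i.
  move=> Xi; have [_ /(_ Xi) [_ Fi _] _] := FP i.
  (* For [j] other than [i] in [X], injectivity puts [gam i] among the generators killed by
     [F j]. *)
  rewrite (fE _ [:: i]) ?big_seq1 // => j; rewrite inE => /eqP ji.
  have [Xj|/FnX //] := pselect (X j); apply: FH => //.
  apply: sum_subgroupl => //; apply: sum_subgroupl => //; apply: in_span_gen.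
  by split; [exact: Xgam | move=> /gam_inj ij; apply: ji; rewrite ij].
exists f; split=> //; split=> [x|b /BX].
  have [s xs0] := fin x.
  rewrite (fE _ (undup s)) ?undup_uniq //; last by move=> j; rewrite mem_undup; apply: xs0.
  apply: subgroup_sum => // j.
  have [Xj|/FnX ->] := pselect (X j); last exact: subgroup0.
  have [_ /(_ Xj) [/(_ x) [z ->] _ _] _] := FP j.
  by apply: subgroupMz => //; exact: XB.
apply: (in_span_min (H := fun y => exists x, f x = y)) => [|x Xx]; last first.
  by exists (gam x); exact: f_gam.
have [f0 _ _] := is_hom_additive hf; split; first by exists 0.
by move=> _ _ [x <-] [y <-]; exists (x - y); rewrite hf.
Qed.
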